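(* Let $a,b$ be real numbers with $1<a<b$. Then $$\pi=\frac{\sqrt{(b^2-a^2)(a^2b^2-1)}}{ab^2\sqrt{b^4-1}}\;\frac{(b^2+1)\,K\!\left(\dfrac{b(a^2-1)}{a(b^2-1)}\right)+(b^2-1)\,K\!\left(\dfrac{b(a^2+1)}{a(b^2+1)}\right)}{F_D^{(3)}\!\left(\tfrac12;\tfrac12,\tfrac12,\tfrac12;1\,\Big|\,\dfrac1{1-b^4},\dfrac1{1-a^2b^2},\dfrac{a^2}{a^2-b^2}\right)}.$$
   Context: $K(k)=\int_0^1\frac{dx}{\sqrt{(1-x^2)(1-k^2x^2)}}$ is the complete elliptic integral of the first kind, as a function of the modulus $k$. The Lauricella function of $n$ variables is $F_D^{(n)}(\alpha;\beta_1,\dots,\beta_n;\gamma\,|\,x_1,\dots,x_n)=\sum_{m_1,\dots,m_n\ge0}\frac{(\alpha)_{m_1+\cdots+m_n}(\beta_1)_{m_1}\cdots(\beta_n)_{m_n}}{(\gamma)_{m_1+\cdots+m_n}\,m_1!\cdots m_n!}x_1^{m_1}\cdots x_n^{m_n}$ for $|x_j|<1$, with $(x)_k$ the Pochhammer symbol. For $\operatorname{Re}\gamma>\operatorname{Re}\alpha>0$ it equals, and outside the region of convergence is defined by analytic continuation through, $\frac{\Gamma(\gamma)}{\Gamma(\alpha)\Gamma(\gamma-\alpha)}\int_0^1\frac{u^{\alpha-1}(1-u)^{\gamma-\alpha-1}}{(1-x_1u)^{\beta_1}\cdots(1-x_nu)^{\beta_n}}\,du$ (principal branches, $x_j\notin[1,\infty)$).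 *)

(* Defs.v *)
From mathcomp Require Import all_boot all_order all_algebra.
From mathcomp Require Import all_classical all_reals all_analysis.

Set Implicit Arguments.
Unset Strict Implicit.
Unset Printing Implicit Defensive.

Import Order.TTheory GRing.Theory Num.Theory.
Import numFieldNormedType.Exports.

Local Open Scope classical_set_scope.
Local Open Scope ring_scope.

Definition ellipticK (R : realType) (k : R) : R :=
  \int[lebesgue_measure]_(x in `[0, 1])
    (Num.sqrt ((1 - x ^+ 2) * (1 - k ^+ 2 * x ^+ 2)))^-1.

Definition pochhammer (R : realType) (x : R) (k : nat) : R :=
  \prod_(i < k) (x + i%:R).

(* Euler's integral; it represents the Gamma function for 0 < s only. *)
Definition Gamma (R : realType) (s : R) : R :=
  \int[lebesgue_measure]_(t in `[0, +oo[) (t `^ (s - 1) * expR (- t)).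

Section Lauricella.
Variables (R : realType) (n : nat).
Implicit Types (alpha gamma : R) (beta x : n.-tuple R) (m : 'I_n -> nat).

Definition lauricellaD_term alpha beta gamma x m : R :=
  pochhammer alpha (\sum_j m j) * \prod_j pochhammer (tnth beta j) (m j)
  / (pochhammer gamma (\sum_j m j) * \prod_j (m j)`!%:R)
  * \prod_j tnth x j ^+ m j.

(* The n-fold series is the limit of its partial sums over the boxes
   {0, ..., N-1}^n. It converges absolutely when all `|x_j| < 1, so that its
   value does not depend on the order of summation. *)
Definition lauricellaD_series alpha beta gamma x : R :=
  limn (fun N : nat => \sum_(m : {ffun 'I_n -> 'I_N})
    lauricellaD_term alpha beta gamma x (fun j => m j)).

(* For x_j < 1 the bases 1 - x_j u are positive, and the real powers below are
   the principal ones. *)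
Definition lauricellaD_integral alpha beta gamma x : R :=
  Gamma gamma / (Gamma alpha * Gamma (gamma - alpha)) *
  \int[lebesgue_measure]_(u in `[0, 1])
    (u `^ (alpha - 1) * (1 - u) `^ (gamma - alpha - 1)
     / \prod_j (1 - tnth x j * u) `^ (tnth beta j)).

(* The series on the open unit polydisc, and elsewhere its continuation by the
   Euler integral, meaningful for 0 < alpha < gamma and all x_j < 1. *)
Definition lauricellaD alpha beta gamma x : R :=
  if [forall j, `|tnth x j| < 1] then lauricellaD_series alpha beta gamma x
  else lauricellaD_integral alpha beta gamma x.

End Lauricella.

(* Main.v *)
Require Import Defs.
From mathcomp Require Import all_boot all_order all_algebra.
From mathcomp Require Import all_classical all_reals all_analysis.
From mathcomp Require Import measurable_realfun.
From mathcomp Require Import ring lra.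

(** The parameters of the Lauricella function are all 1/2, so its Euler integral is
    the integral of the inverse square root of u (1 - u) (1 - x_1 u) (1 - x_2 u)
    (1 - x_3 u), a period of a curve of genus 2.  For the three arguments of the
    theorem the curve has extra involutions, and the period splits into two
    elliptic ones.

    Put u = cos(t)^2 and s = sin t.  Up to an explicit factor, the period becomes
    the integral J over [0, pi/2] of 1 / sqrt(C(s^2)), where
    C(y) = (b^4 - y) (b^2 - a^2 y) (a^2 b^2 - y) ([lauricellaD_genus2]).
    For e = 1 and e = -1, the function x = (b^2 + e) s / (b^2 + e s^2) is invariant
    under s |-> e b^2 / s, and both 1 - x^2 and 1 - k^2 x^2, with
    k = b (a^2 + e) / (a (b^2 + e)), are factors of C(s^2) up to squares.  Hence
    the substitution t |-> x turns the elliptic integral K(k) into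
    a (b^2 + e) times the integral of (b^2 - e s^2) / sqrt(C(s^2))
    ([ellipticK_sin]).  In (b^2 + 1) K(k_-) + (b^2 - 1) K(k_+) the terms in s^2
    cancel, which leaves 2 a b^2 (b^4 - 1) J ([ellipticK_sum]).  As J > 0, the
    quotient of the two is the stated value of pi.

    The Lauricella function is given by its power series when all |x_j| < 1 and
    by the Euler integral otherwise, and both must be brought to the
    trigonometric form ([lauricellaD_half]).  For the Euler integral this is the
    substitution u = sin(t)^2, with Gamma(1/2)^2 = pi.  For the series, Wallis'
    formula expresses (1/2)_M / M! as an integral of sin(t)^(2M), so the sum over
    a box is the integral of a product of partial sums of the binomial series of
    (1 - y)^(-1/2); dominated convergence gives the limit.

    The integrands of K, of the Euler integral and of Gamma(1/2) blow up at ends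
    of their intervals.  They are nonnegative, so the substitution rule on compact intervals extends
    to an exhausted domain by monotone convergence
    ([ge0_substitution_bigcup]). *)

Set Implicit Arguments.
Unset Strict Implicit.
Unset Printing Implicit Defensive.

Import Order.TTheory GRing.Theory Num.Theory.
Import numFieldNormedType.Exports.

Local Open Scope classical_set_scope.
Local Open Scope ring_scope.

(** * Substitution in integrals of nonnegative functions *)

(** The classical rule holds on each [a_n, b_n], where all functions are continuous;
    both sides then converge monotonically, as F increases on every [a_n, b_n] and
    so maps an exhaustion of D to one of F(D). The union may be an open or an
    unbounded interval. *)
Lemma ge0_substitution_bigcup (R : realType) (F f G : R -> R) (a b : R^nat) :
  nonincreasing_seq a -> nondecreasing_seq b -> (forall n, a n < b n) ->
  let D := \bigcup_n `[a n, b n]%classic in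
  (forall x, D x -> is_derive x 1 F (f x)) ->
  (forall x, D x -> 0 < f x) ->
  (forall x, D x -> {for x, continuous f}) ->
  (forall x, D x -> {for F x, continuous G}) ->
  (forall x, D x -> 0 <= G (F x)) ->
  (\int[lebesgue_measure]_(y in F @` D) (G y)%:E =
   \int[lebesgue_measure]_(x in D) (G (F x) * f x)%:E)%E.
Proof.
move=> a_dec b_inc ltab D dF f_gt0 cf cG G_ge0.
have subD n x : x \in `[a n, b n] -> D x by move=> xab; exists n.
have cF x : D x -> {for x, continuous F}.
  by move=> /dF dFx; apply/differentiable_continuous/derivable1_diffP.
have cFw n : {within `[a n, b n], continuous F}.
  by apply: continuous_in_subspaceT => x /[1!inE] /subD /cF.
have F_inc n : {in `[a n, b n] &, {homo F : x y / x < y}}.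
  apply: gtr0_derive1_lt_cc => // x /subset_itv_oo_cc /subD Dx.
    by have := dF x Dx.
  by have := dF x Dx => ?; rewrite derive1E derive_val f_gt0.
have F_le n x : x \in `[a n, b n] -> F (a n) <= F x <= F (b n).
  move=> xab; have [xa xb] : a n <= x /\ x <= b n by move: xab; rewrite in_itv => /andP.
  have an : a n \in `[a n, b n] by rewrite in_itv/= lexx ltW.
  have bn : b n \in `[a n, b n] by rewrite in_itv/= lexx ltW.
  move: xa xb; rewrite !le_eqVlt => /predU1P[<-|/(F_inc n _ _ an xab) ->].
    by rewrite eqxx/= => _; rewrite (F_inc n _ _ an bn)// orbT.
  by rewrite orbT/= => /predU1P[<-|/(F_inc n _ _ xab bn) ->]; rewrite ?eqxx ?orbT.
have imF n y : y \in `[F (a n), F (b n)] -> exists2 x, x \in `[a n, b n] & F x = y.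
  rewrite in_itv/= => /andP[yl yr]; apply: IVT => //; first exact: ltW.
  by rewrite ge_min yl le_max yr orbT.
have -> : F @` D = \bigcup_n `[F (a n), F (b n)]%classic.
  apply/seteqP; split=> [_ [x [n _ xab] <-]|y [n _ /imF[x xab <-]]].
    by exists n => //; exact: F_le.
  by exists x => //; exists n.
have ndD : nondecreasing_seq (fun n => [set` `[a n, b n]]).
  move=> m n mn; rewrite subsetEset => x /=; rewrite !in_itv/= => /andP[ax xb].
  by rewrite (le_trans (a_dec _ _ mn))//= (le_trans xb)// b_inc.
have ab_in n m : (n <= m)%N -> a n \in `[a m, b m] /\ b n \in `[a m, b m].
  move=> nm; rewrite !in_itv/= a_dec//= b_inc//= !andbT; split.
    exact: (le_trans (ltW (ltab n)) (b_inc _ _ nm)).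
  exact: (le_trans (a_dec _ _ nm) (ltW (ltab n))).
have ndE : nondecreasing_seq (fun n => [set` `[F (a n), F (b n)]]).
  move=> m n mn; rewrite subsetEset => x /=; rewrite !in_itv/= => /andP[ax xb].
  have [/F_le/andP[am _] /F_le/andP[_ bm]] := ab_in _ _ mn.
  by rewrite (le_trans am)//= (le_trans xb).
have cGw n : {within `[F (a n), F (b n)], continuous G}.
  apply: continuous_in_subspaceT => y /[1!inE] /imF[x xab <-].
  exact/cG/(subD n).
have eqn n : (\int[lebesgue_measure]_(y in `[F (a n), F (b n)]) (G y)%:E =
    \int[lebesgue_measure]_(x in `[a n, b n]) (G (F x) * f x)%:E)%E.
  have F'E x : x \in `[a n, b n] -> derive1 F x = f x.
    by move=> /subD /dF ?; rewrite derive1E derive_val.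
  have [an bn] : D (a n) /\ D (b n).
    by have [? ?] := ab_in n n (leqnn n); split; exact: (subD n).
  rewrite integration_by_substitution_increasing//; first last.
  - split=> [x /subset_itv_oo_cc /subD /dF//||].
      exact/cvg_at_right_filter/cF.
    exact/cvg_at_left_filter/cF.
  - apply/cvg_ex; exists (f (b n)).
    apply: cvg_trans (cvg_at_left_filter (cf _ bn)); apply: near_eq_cvg.
    near=> x; rewrite F'E// in_itv/=; apply/andP; split.
      by near: x; apply: nbhs_left_ge; exact: ltab.
    by near: x; exact: nbhs_left_le.
  - apply/cvg_ex; exists (f (a n)).
    apply: cvg_trans (cvg_at_right_filter (cf _ an)); apply: near_eq_cvg.
    near=> x; rewrite F'E// in_itv/=; apply/andP; split.
      by near: x; exact: nbhs_right_ge.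
    by near: x; apply: nbhs_right_le; exact: ltab.
  - move=> x xab; rewrite /prop_for /continuous_at.
    have xab' := subset_itv_oo_cc xab.
    rewrite F'E//; apply: cvg_trans (cf _ (subD n _ xab')); apply: near_eq_cvg.
    near=> y; rewrite F'E//; apply: subset_itv_oo_cc.
    near: y; exact: near_in_itvoo.
  - exact: ltW.
  apply: eq_integral => x /[1!inE] xab.
  by rewrite fctE F'E.
have mG n : measurable_fun `[F (a n), F (b n)] (fun y => (G y)%:E).
  apply/measurable_EFinP; apply: subspace_continuous_measurable_fun.
    exact: measurable_itv.
  exact: cGw.
have mGF n : measurable_fun `[a n, b n] (fun x => (G (F x) * f x)%:E).
  apply/measurable_EFinP; apply: subspace_continuous_measurable_fun.
    exact: measurable_itv.
  apply: continuous_in_subspaceT => x /[1!inE] /subD Dx.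
  apply: continuousM; last exact: cf.
  by apply: continuous_comp; [exact: cF|exact: cG].
have G0 n y : [set` `[F (a n), F (b n)]] y -> (0 <= (G y)%:E)%E.
  by move=> /imF[x xab <-]; rewrite lee_fin; exact/G_ge0/(subD n).
have GF0 n x : [set` `[a n, b n]] x -> (0 <= (G (F x) * f x)%:E)%E.
  by move=> /subD Dx; rewrite lee_fin mulr_ge0// ?G_ge0// ltW// f_gt0.
have lim1 := ge0_nondecreasing_set_cvg_integral (mu := lebesgue_measure)
  ndE (fun i => measurable_itv _) mG G0.
have lim2 := ge0_nondecreasing_set_cvg_integral (mu := lebesgue_measure)
  ndD (fun i => measurable_itv _) mGF GF0.
rewrite -(cvg_lim (@ereal_hausdorff R) lim1) -(cvg_lim (@ereal_hausdorff R) lim2).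
by congr (limn _); apply/funext => n; rewrite eqn.
Unshelve. all: by end_near. Qed.

(** The margins (b - a) / (n + 3) exhaust ]a, b[, and F(]a, b[) = ]F a, F b[ by the
    intermediate value theorem. Neither f nor G need be bounded near the ends. *)
Lemma ge0_substitution_oo (R : realType) (F f G : R -> R) (a b : R) :
  a < b -> {within `[a, b], continuous F} ->
  {in `]a, b[, forall x : R, is_derive x 1 F (f x)} ->
  {in `]a, b[, forall x, 0 < f x} ->
  {in `]a, b[, continuous f} ->
  {in `]F a, F b[, continuous G} ->
  {in `]F a, F b[, forall y, 0 <= G y} ->
  (\int[lebesgue_measure]_(y in `]F a, F b[) (G y)%:E =
   \int[lebesgue_measure]_(x in `]a, b[) (G (F x) * f x)%:E)%E.
Proof.
move=> ab cF dF f_gt0 cf cG G_ge0.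
have F_inc : {in `[a, b] &, {homo F : x y / x < y}}.
  apply: gtr0_derive1_lt_cc => // x xab; first by have := dF x xab.
  by have := dF x xab => ?; rewrite derive1E derive_val f_gt0.
have Foo x : x \in `]a, b[ -> F x \in `]F a, F b[.
  move=> xab; rewrite in_itv/=; move: (xab); rewrite in_itv/= => /andP[ax xb].
  by rewrite !F_inc// ?in_itv/= ?lexx ?ltW.
pose h n : R := (b - a) / n.+3%:R.
have h_gt0 n : 0 < h n by rewrite divr_gt0// subr_gt0.
have h_dec m n : (m <= n)%N -> h n <= h m.
  move=> mn; rewrite ler_pM2l ?subr_gt0// lef_pV2 ?posrE//.
  by rewrite ler_nat.
(* The 3 in the margin keeps the left end below the right end for n = 0. *)
have h_lt n : h n + h n < b - a.
  have e : h n * n.+3%:R = b - a by rewrite mulfVK.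
  have le3 : 3 <= n.+3%:R :> R by rewrite ler_nat.
  have := h_gt0 n; rewrite -e; nra.
have subab n x : x \in `[a + h n, b - h n] -> x \in `]a, b[.
  rewrite !in_itv/= => /andP[ax xb]; have := h_gt0 n => hn.
  by apply/andP; split; lra.
have Dab : `]a, b[%classic = \bigcup_n `[a + h n, b - h n]%classic.
  apply/seteqP; split=> [x /=|x [n _]]; last exact: subab.
  rewrite in_itv/= => /andP[ax xb].
  have [n hn] : exists n, h n <= Num.min (x - a) (b - x).
    have m_gt0 : 0 < Num.min (x - a) (b - x) by rewrite lt_min !subr_gt0 ax.
    exists (Num.truncn ((b - a) / Num.min (x - a) (b - x))).
    rewrite ler_pdivrMr// mulrC -ler_pdivrMr//; apply: ltW.
    by rewrite (lt_le_trans (truncnS_gt _))// ler_nat (leq_trans (leqnSn _)) // leqnSn.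
  exists n => //=; rewrite in_itv/=; move: hn; rewrite le_min => /andP[h1 h2].
  by apply/andP; split; lra.
have FD : F @` `]a, b[ = `]F a, F b[%classic.
  apply/seteqP; split=> [_ [x xab <-]|y]; first exact: Foo.
  rewrite /= in_itv/= => /andP[ya yb].
  have [||x xab xy] := @IVT _ F a b y (ltW ab) => //.
    by rewrite ge_min (ltW ya) le_max (ltW yb) orbT.
  exists x => //=; move: xab; rewrite !in_itv/= => /andP[ax xb].
  apply/andP; split; rewrite lt_neqAle ?ax ?xb andbT.
    by apply: contraTneq ya => ->; rewrite -xy ltxx.
  by apply: contraTneq yb => <-; rewrite -xy ltxx.
have := @ge0_substitution_bigcup R F f G (fun n => a + h n) (fun n => b - h n).
cbv zeta; rewrite -Dab FD; apply => //.
- by move=> m n mn; rewrite lerD2l h_dec.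
- by move=> m n mn; rewrite lerD2l lerN2 h_dec.
- by move=> n; have := h_lt n; lra.
- by move=> x xab; apply/cG/Foo.
- by move=> x xab; apply/G_ge0/Foo.
Qed.

(** * Values of the Gamma function *)

Lemma powR_half (R : realType) (x : R) : 0 <= x -> x `^ (1 / 2) = Num.sqrt x.
Proof. by move=> x0; rewrite mul1r powR12_sqrt. Qed.

(** At x = 0 both sides are 0, by the conventions for negative powers of 0 and for
    the inverse of 0. So the integrands below agree on closed intervals. *)
Lemma powR_half_sub1 (R : realType) (x : R) :
  0 <= x -> x `^ (1 / 2 - 1) = (Num.sqrt x)^-1.
Proof.
move=> x0; rewrite -powR_half// -powRN; congr (_ `^ _).
by field.
Qed.

(** The integrand is the density of the exponential law of rate 1. *)
Lemma Gamma1 (R : realType) : Gamma 1 = 1 :> R.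
Proof.
rewrite /Gamma Rintegral_mkcond /Rintegral -[RHS]/(fine 1%E); congr fine.
rewrite -(integral_exponential_pdf (@ltr01 R)); apply: eq_integral => t _.
congr EFin; rewrite /exponential_pdf !patchE; case: ifP => // _.
by rewrite subrr powRr0 !mul1r mulN1r.
Qed.

(** The substitution t = s^2 on ]0, +oo[ leads to the Gauss integral. *)
Lemma Gamma_half (R : realType) : Gamma (1 / 2) = Num.sqrt pi :> R.
Proof.
pose G (t : R) := (Num.sqrt t)^-1 * expR (- t).
have cG t : 0 < t -> {for t, continuous G}.
  move=> t0; apply: continuousM.
    by apply: continuousV; [rewrite sqrtr_eq0 -ltNge|exact: sqrt_continuous].
  by apply: continuous_comp; [exact: opp_continuous|exact: continuous_expR].
rewrite /Gamma (_ : \int[_]_(_ in _) _ =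
    \int[lebesgue_measure]_(t in `[0, +oo[) G t); last first.
  apply: eq_Rintegral => t; rewrite inE/= in_itv/= andbT => t0.
  by rewrite powR_half_sub1.
rewrite /Rintegral -integral_itv_obnd_cbnd; last first.
  apply/measurable_EFinP; apply: open_continuous_measurable_fun.
    exact: interval_open.
  by move=> t; rewrite inE/= in_itv/= andbT => /cG.
pose a n : R := n.+2%:R^-1.
pose b n : R := n.+2%:R.
have a_gt0 n : 0 < a n by rewrite invr_gt0.
have Dab : `]0, +oo[%classic = \bigcup_n `[a n, b n]%classic.
  apply/seteqP; split=> [x /=|x [n _] /=]; rewrite !in_itv/= andbT; last first.
    by move=> /andP[ax _]; exact: lt_le_trans ax.
  move=> x0; exists (Num.truncn (x^-1) + Num.truncn x)%N => //=.
  rewrite in_itv/=; apply/andP; split.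
    rewrite -[leRHS]invrK lef_pV2 ?posrE ?invr_gt0// ltW//.
    rewrite (lt_le_trans (truncnS_gt _))// ler_nat ltnS -addnS leq_addr//.
  rewrite /b ltW// (lt_le_trans (truncnS_gt _))// ler_nat ltnS -addSn.
  by rewrite leq_addl.
have FD : (fun t : R => t ^+ 2) @` `]0, +oo[ = `]0, +oo[%classic.
  apply/seteqP; split=> [_ [x /= + <-]|y /=]; rewrite !in_itv/= !andbT.
    by move=> x0; rewrite exprn_gt0.
  move=> y0; exists (Num.sqrt y); last by rewrite sqr_sqrtr// ltW.
  by rewrite /= in_itv/= sqrtr_gt0 y0.
have -> : (\int[lebesgue_measure]_(x in `]0%R, +oo[) (G x)%:E =
    \int[lebesgue_measure]_(x in `]0%R, +oo[) (G (x ^+ 2) * (2 * x))%:E)%E.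
  have := @ge0_substitution_bigcup R (fun t => t ^+ 2) (fun t => 2 * t) G a b.
  cbv zeta; rewrite -Dab FD; apply.
  - by move=> m n mn; rewrite lef_pV2 ?posrE// ler_nat !ltnS.
  - by move=> m n mn; rewrite ler_nat !ltnS.
  - move=> n; rewrite /a /b (@lt_trans _ _ 1)//; last by rewrite ltr1n.
    by rewrite invf_lt1 ?ltr1n.
  - move=> x _; apply: is_derive_eq. rewrite /GRing.scale/=; ring.
  - by move=> x; rewrite /= in_itv/= andbT => x0; rewrite mulr_gt0.
  - by move=> x _; apply: continuousM; [exact: cst_continuous|exact: cvg_id].
  - move=> x; rewrite /= in_itv/= andbT => x0.
    by apply: cG; rewrite exprn_gt0.
  - move=> x; rewrite /= in_itv/= andbT => x0.
    by rewrite mulr_ge0 ?invr_ge0 ?sqrtr_ge0 ?expR_ge0.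
rewrite (_ : integral _ _ _ =
  (2%:E * \int[lebesgue_measure]_(x in `[0%R, +oo[) (gauss_fun x)%:E)%E).
  rewrite integral0y_gauss -EFinM/= mulrC mulfVK//.
rewrite -ge0_integralZl_EFin//; last 2 first.
- by move=> x _; rewrite lee_fin gauss_fun_ge0.
- by apply/measurable_EFinP/measurable_funTS; exact: measurable_gauss_fun.
rewrite -[RHS]integral_itv_obnd_cbnd; last first.
  apply/measurable_EFinP/measurable_funM => //.
  by apply/measurable_funTS; exact: measurable_gauss_fun.
apply: eq_integral => x; rewrite inE/= in_itv/= andbT => x0.
rewrite -EFinM; congr EFin; rewrite /G /gauss_fun sqrtr_sqr gtr0_norm//.
by field; rewrite gt_eqF.
Qed.

(** * Wallis' formula *)

(** Lets a derivative computed by combinators be stated in any equal form, both of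
    the function and of the value. *)
Lemma is_derive_ext (R : realType) (f g : R -> R) (x df dg : R) :
  is_derive x 1 f df -> f =1 g -> df = dg -> is_derive x 1 g dg.
Proof. by move=> dfx /funext <- <-. Qed.

Lemma is_derive1M (R : realType) (f g : R -> R) (x df dg : R) :
  is_derive x 1 f df -> is_derive x 1 g dg ->
  is_derive x 1 (fun t => f t * g t) (df * g x + f x * dg).
Proof.
move=> hf hg; apply: (@is_derive_eq R R R _ _ _ _ _ (is_deriveM hf hg)).
by rewrite /GRing.scale/= addrC [g x * _]mulrC.
Qed.

Lemma is_derive1X (R : realType) (f : R -> R) n (x df : R) :
  is_derive x 1 f df ->
  is_derive x 1 (fun t => f t ^+ n) (n%:R * f x ^+ n.-1 * df).
Proof.
move=> hf; have -> : (fun t => f t ^+ n) = f ^+ n.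
  by apply/funext => t; rewrite fctE.
exact: is_deriveX hf.
Qed.

Lemma pochhammerS (R : realType) (x : R) k :
  pochhammer x k.+1 = pochhammer x k * (x + k%:R).
Proof. by rewrite /pochhammer big_ord_recr. Qed.

Lemma pochhammer1 (R : realType) k : pochhammer (1 : R) k = k`!%:R.
Proof.
elim: k => [|k IH]; first by rewrite /pochhammer big_ord0.
by rewrite pochhammerS IH factS natrM mulrC nat1r.
Qed.

(** The coefficients C(2m, m) / 4^m of the power series of (1 - y)^(-1/2). *)
Definition half_coef (R : realType) (m : nat) : R := pochhammer (1 / 2) m / m`!%:R.

Lemma half_coef0 (R : realType) : half_coef R 0 = 1.
Proof. by rewrite /half_coef /pochhammer big_ord0 divr1. Qed.

Lemma half_coefS (R : realType) m :
  m.+1%:R * half_coef R m.+1 = (m%:R + 1 / 2) * half_coef R m.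
Proof.
rewrite /half_coef pochhammerS factS natrM; field.
by rewrite nat1r !pnatr_eq0 -lt0n fact_gt0.
Qed.

Lemma half_coef_ge0 (R : realType) m : 0 <= half_coef R m.
Proof.
rewrite divr_ge0//; apply: prodr_ge0 => i _.
by rewrite addr_ge0// divr_ge0.
Qed.

Lemma half_coef_le1 (R : realType) m : half_coef R m <= 1.
Proof.
elim: m => [|m IH]; first by rewrite half_coef0.
have m1 : 0 < m.+1%:R :> R by rewrite ltr0n.
rewrite -(ler_pM2l m1) half_coefS mulr1 -natr1.
have m0 : 0 <= m%:R + 1 / 2 :> R by rewrite addr_ge0.
by have := ler_wpM2l m0 IH; rewrite mulr1 => /le_trans; apply; lra.
Qed.

Lemma integrable_quarter (R : realType) (h : R -> R) :
  continuous h -> lebesgue_measure.-integrable `[0, pi / 2] (EFin \o h).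
Proof.
move=> ch; apply: continuous_compact_integrable.
  exact: segment_compact.
exact: continuous_subspaceT.
Qed.

Lemma pihalf_gt0 (R : realType) : 0 < pi / 2 :> R.
Proof. by case/andP: (pihalf_02 R). Qed.

Lemma lebesgue_measure_quarter (R : realType) :
  fine (lebesgue_measure (`[0, pi / 2]%classic : set R)) = pi / 2.
Proof.
by rewrite lebesgue_measure_itv/= lte_fin pihalf_gt0/= subr0.
Qed.

(** The recurrence [half_coefS] comes from integrating the derivative of
    sin(t)^(2m+1) cos(t), which vanishes at both ends. *)
Lemma Wallis (R : realType) m :
  \int[lebesgue_measure]_(t in `[0, pi / 2]) (sin t ^+ 2) ^+ m
  = pi / 2 * half_coef R m.
Proof.
have csin n : continuous (fun t : R => sin t ^+ n).
  by move=> t; apply: (@continuous_comp _ _ _ sin (fun x => x ^+ n));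
    [exact: continuous_sin|exact: exprn_continuous].
under eq_Rintegral do rewrite -exprM.
elim: m => [|m IH].
  under eq_Rintegral do rewrite muln0 expr0.
  rewrite Rintegral_cst// half_coef0 mulr1 mul1r.
  exact: lebesgue_measure_quarter.
pose f (t : R) := (2 * m).+1%:R * sin t ^+ (2 * m) - (2 * m.+1)%:R * sin t ^+ (2 * m.+1).
have cf : continuous f.
  have cf t : {for t, continuous f}.
    by apply: continuousB; apply: continuousM; do ?exact: csin; exact: cst_continuous.
  exact: cf.
pose F (t : R) := sin t ^+ (2 * m).+1 * cos t.
have dF (t : R) : is_derive t 1 F (f t).
  apply: (is_derive_ext (is_derive1M (is_derive1X (2 * m).+1 (is_derive_sin t))
    (is_derive_cos t))) => //.
  rewrite /GRing.scale/= /f mulnS add2n !exprS.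
  have -> : sin t * (sin t * sin t ^+ (2 * m)) = (1 - cos t ^+ 2) * sin t ^+ (2 * m).
    by rewrite -sin2cos2; ring.
  have -> : sin t * sin t ^+ (2 * m) * - sin t = (cos t ^+ 2 - 1) * sin t ^+ (2 * m).
    by rewrite cos2sin2; ring.
  by rewrite -[(2 * m).+2%:R]natr1; ring.
have : \int[lebesgue_measure]_(t in `[0, pi / 2]) f t = 0.
  have cF t : {for t, continuous F}.
    by apply/differentiable_continuous/derivable1_diffP; have := dF t.
  rewrite /Rintegral (@continuous_FTC2 _ _ F) ?pihalf_gt0//.
  - by rewrite /F sin0 cos_pihalf expr0n mulr0 mul0r /= subr0.
  - exact: continuous_subspaceT.
  - split=> [t _||]; first by have := dF t.
      exact/cvg_at_right_filter/cF.
    exact/cvg_at_left_filter/cF.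
  - by move=> t _; rewrite derive1E; have := dF t => ?; rewrite derive_val.
rewrite /f RintegralB//; last 2 first.
- by apply: integrable_quarter => t; apply: cvgM; [exact: cvg_cst|exact: csin].
- by apply: integrable_quarter => t; apply: cvgM; [exact: cvg_cst|exact: csin].
rewrite !RintegralZl//; do ?exact: integrable_quarter.
rewrite IH => /eqP; rewrite subr_eq0 => /eqP e.
apply: (@mulfI _ (2 * m.+1)%:R); first by rewrite pnatr_eq0 muln_eq0.
rewrite -{}e; transitivity (pi * (m.+1%:R * half_coef R m.+1)).
  by rewrite half_coefS -natr1 natrM; field.
by rewrite natrM; field.
Qed.

(** * The binomial series of (1 - y)^(-1/2) *)

Definition half_sum (R : realType) (N : nat) (y : R) : R :=
  \sum_(m < N) half_coef R m * y ^+ m.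

Lemma continuous_sqrt_inv (R : realType) (f : R -> R) (x : R) :
  0 < f x -> {for x, continuous f} ->
  {for x, continuous (fun t => (Num.sqrt (f t))^-1)}.
Proof.
move=> fx cf; apply: continuousV; first by rewrite sqrtr_eq0 -ltNge.
by apply: continuous_comp; [exact: cf|exact: sqrt_continuous].
Qed.

Lemma is_derive_half_sum (R : realType) N (y : R) :
  is_derive y 1 (half_sum N)
    (\sum_(m < N) m%:R * half_coef R m * y ^+ m.-1).
Proof.
have -> : half_sum N = \sum_(m < N) (fun y : R => half_coef R m * y ^+ m).
  by apply/funext => t; rewrite fct_sumE.
apply: is_derive_sum => m.
have := is_derive1M (is_derive_cst (half_coef R m) y 1)
  (is_derive1X m (is_derive_id y 1)).
by move/is_derive_ext; apply => //; rewrite mul0r add0r mulr1 mulrCA mulrA.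
Qed.

(** The function (1 - y)^(-1/2) solves (1 - y) P' = P / 2, and its partial sums do so
    up to one monomial, since the recurrence of the coefficients makes the sum
    telescope. *)
Lemma half_sum_ode (R : realType) N (y : R) :
  (1 - y) * (\sum_(m < N) m%:R * half_coef R m * y ^+ m.-1) - half_sum N y / 2
  = - (N%:R * half_coef R N * y ^+ N.-1).
Proof.
rewrite /half_sum; elim: N => [|N IH].
  by rewrite !big_ord0 !mul0r mulr0 subr0 oppr0.
rewrite !big_ord_recr/= half_coefS.
set S := \sum_(m < N) _ in IH *; set T := \sum_(m < N) _ in IH *.
have -> : (1 - y) * (S + N%:R * half_coef R N * y ^+ N.-1) -
  (T + half_coef R N * y ^+ N) / 2 =
  ((1 - y) * S - T / 2) + (1 - y) * (N%:R * half_coef R N * y ^+ N.-1)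
    - half_coef R N * y ^+ N / 2 by field.
rewrite IH; case: N {IH S T} => [|N]; first by rewrite !mul0r expr0; field.
by rewrite /= exprS; field.
Qed.

(** With s = sqrt r, the factor N s^N is bounded by 1 / (1 - s), because it is at
    most 1 + s + ... + s^(N-1); the remaining factor s^N tends to 0. *)
Lemma cvg_natr_expr (R : realType) (r : R) : 0 <= r < 1 ->
  (fun N => N%:R * r ^+ N) @ \oo --> (0 : R).
Proof.
move=> /andP[r0 r1].
pose s := Num.sqrt r.
have s0 : 0 <= s by exact: sqrtr_ge0.
have s1 : s < 1 by rewrite -[ltRHS]sqrtr1 ltr_sqrt.
have bern N : N%:R * s ^+ N * (1 - s) <= 1 - s ^+ N.
  elim: N => [|N IH]; first by rewrite !mul0r expr0 subrr.
  have sN0 : 0 <= s ^+ N by exact: exprn_ge0.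
  have sN1 : s ^+ N <= 1 by apply: exprn_ile1 => //; exact: ltW.
  rewrite -natr1 exprS.
  have := ler_wpM2l s0 IH.
  have : s * s ^+ N * (1 - s) <= 1 - s.
    by rewrite ler_piMl ?subr_ge0 ?(ltW s1)// mulr_ile1// ltW.
  lra.
have sub1 : 0 < 1 - s by rewrite subr_gt0.
apply: (@squeeze_cvgr _ _ _ _ (cst 0) (fun N => (1 - s)^-1 * s ^+ N)).
- apply: nearW => N; rewrite mulr_ge0 ?exprn_ge0//=.
  rewrite -[X in X ^+ N](sqr_sqrtr r0) -/s exprAC expr2 mulrA.
  rewrite ler_wpM2r ?exprn_ge0//.
  rewrite -[leRHS]mul1r ler_pdivlMr//.
  by rewrite (le_trans (bern N))// gerBl exprn_ge0.
- exact: cvg_cst.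
- rewrite -[X in _ --> X](mulr0 (1 - s)^-1).
  by apply: cvgMr; apply: cvg_expr; rewrite ger0_norm.
Qed.

(** By [half_sum_ode], the product P(ty) sqrt(1 - ty) has a single monomial in the
    numerator of its derivative; the mean value theorem for t in [0, 1] gives the
    remainder. Working with t treats both signs of y at once. *)
Lemma half_sum_remainder (R : realType) N (y : R) : `|y| < 1 ->
  exists2 c : R, 0 <= c <= 1 & half_sum N.+1 y * Num.sqrt (1 - y) =
    1 - N.+1%:R * half_coef R N.+1 * (c * y) ^+ N * y / Num.sqrt (1 - c * y).
Proof.
move=> y1.
have ty_lt1 (t : R) : 0 <= t <= 1 -> 0 < 1 - t * y.
  move=> /andP[t0 t1]; rewrite subr_gt0; apply: le_lt_trans (ler_norm _) _.
  by rewrite normrM ger0_norm// (le_lt_trans _ y1)// ler_piMl.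
pose h (t : R) := half_sum N.+1 (t * y) * Num.sqrt (1 - t * y).
pose dh (t : R) :=
  - (N.+1%:R * half_coef R N.+1 * (t * y) ^+ N * y / Num.sqrt (1 - t * y)).
have dg (t : R) : is_derive t 1 (fun t : R => t * y) y.
  have := is_derive1M (is_derive_id t 1) (is_derive_cst y t 1).
  by move/is_derive_ext; apply => //; rewrite mulr0 addr0 mul1r.
have dh_h (t : R) : 0 <= t <= 1 -> is_derive t 1 h (dh t).
  move=> /ty_lt1 ty.
  have d1 := @is_derive1_comp R (half_sum N.+1) _ t _ _ (is_derive_half_sum N.+1 _) (dg t).
  have d2 : is_derive t 1 (fun t => 1 - t * y) (- y).
    have := is_deriveB (is_derive_cst (1 : R) t 1) (dg t).
    by move/is_derive_ext; apply => //; rewrite sub0r.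
  have d3 := @is_derive1_comp R Num.sqrt _ t _ _ (is_derive1_sqrt ty) d2.
  move: (is_derive1M d1 d3) => /is_derive_ext; apply => //.
  have -> : dh t = - (N.+1%:R * half_coef R N.+1 * (t * y) ^+ N) * y / Num.sqrt (1 - t * y).
    by rewrite /dh !mulNr.
  have /= <- := half_sum_ode N.+1 (t * y).
  have sq := sqr_sqrtr (ltW ty).
  have s0 : Num.sqrt (1 - t * y) != 0 by rewrite sqrtr_eq0 -ltNge.
  set s := Num.sqrt _ in sq s0 *; rewrite -sq.
  by field.
have [t|t|c] := @MVT_segment R h dh 0 1 ler01.
- by move=> /subset_itv_oo_cc; rewrite in_itv/=; exact: dh_h.
- by apply: derivable_within_continuous => z; rewrite in_itv/= => /dh_h [].
rewrite in_itv/= => c01; rewrite /h /dh !mul1r !mul0r !subr0 sqrtr1 !mulr1.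
have -> : half_sum N.+1 (0 : R) = 1.
  rewrite /half_sum big_ord_recl /= half_coef0 expr0 mulr1 big1 ?addr0// => m _.
  by rewrite /bump /= exprS mul0r mulr0.
by move=> e; exists c => //; rewrite -e; ring.
Qed.

(** The remainder in [half_sum_remainder] is nonnegative for y >= 0. *)
Lemma half_sum_le (R : realType) N (y : R) : 0 <= y < 1 ->
  half_sum N y <= (Num.sqrt (1 - y))^-1.
Proof.
move=> /andP[y0 y1]; case: N => [|N].
  by rewrite /half_sum big_ord0 invr_ge0 sqrtr_ge0.
have s0 : 0 < Num.sqrt (1 - y) by rewrite sqrtr_gt0 subr_gt0.
have [|c /andP[c0 c1] e] := @half_sum_remainder R N y; first by rewrite ger0_norm.
rewrite -[leRHS]mul1r ler_pdivlMr// e gerBl.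
apply: divr_ge0; last exact: sqrtr_ge0.
have cy : 0 <= c * y by exact: mulr_ge0.
apply: mulr_ge0 y0; apply: mulr_ge0; last exact: exprn_ge0.
by apply: mulr_ge0; last exact: half_coef_ge0.
Qed.

(** A bound uniform in N: the dominating function for the multiple series. *)
Lemma norm_half_sum_le (R : realType) N (y : R) : `|y| < 1 ->
  `|half_sum N y| <= (Num.sqrt (1 - `|y|))^-1.
Proof.
move=> y1; apply: (@le_trans _ _ (half_sum N `|y|)); last first.
  by apply: half_sum_le; rewrite normr_ge0.
apply: le_trans (ler_norm_sum _ _ _) _; apply: ler_sum => m _.
by rewrite normrM normrX ger0_norm ?half_coef_ge0.
Qed.

(** As the coefficients are at most 1, the remainder of [half_sum_remainder] is at
    most a constant times N |y|^N. *)
Lemma cvg_half_sum (R : realType) (y : R) : `|y| < 1 ->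
  (half_sum N y @[N --> \oo]) --> (Num.sqrt (1 - y))^-1.
Proof.
move=> y1.
have y_lt1 : y < 1 by exact: le_lt_trans (ler_norm _) y1.
have s0 : 0 < Num.sqrt (1 - y) by rewrite sqrtr_gt0 subr_gt0.
have s1 : 0 < Num.sqrt (1 - `|y|) by rewrite sqrtr_gt0 subr_gt0.
rewrite -(cvg_shiftS (fun N => half_sum N y)).
have small : (fun N => (Num.sqrt (1 - `|y|) * Num.sqrt (1 - y))^-1 *
    (N.+1%:R * `|y| ^+ N.+1)) @ \oo --> (0 : R).
  rewrite -[X in _ --> X](mulr0 (Num.sqrt (1 - `|y|) * Num.sqrt (1 - y))^-1).
  apply: cvgMr; rewrite (cvg_shiftS (fun N => N%:R * `|y| ^+ N)).
  by apply: cvg_natr_expr; rewrite normr_ge0.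
pose L := (Num.sqrt (1 - y))^-1.
have bound N : `|half_sum N.+1 y - L| <=
    (Num.sqrt (1 - `|y|) * Num.sqrt (1 - y))^-1 * (N.+1%:R * `|y| ^+ N.+1).
  have [c /andP[c0 c1] e] := @half_sum_remainder R N y y1.
  have -> : half_sum N.+1 y - L = - (N.+1%:R * half_coef R N.+1 * (c * y) ^+ N * y
      / Num.sqrt (1 - c * y) / Num.sqrt (1 - y)).
    rewrite /L -[half_sum _ _](mulfK (lt0r_neq0 s0)) e; ring.
  have cy : `|c * y| <= `|y| by rewrite normrM ger0_norm// ler_piMl.
  have sc : Num.sqrt (1 - `|y|) <= Num.sqrt (1 - c * y).
    rewrite ler_wsqrtr// lerD2l lerN2; exact: le_trans (ler_norm _) cy.
  have sc0 := lt_le_trans s1 sc.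
  move: (half_coef_ge0 R N.+1) (half_coef_le1 R N.+1).
  move: (half_coef R N.+1) => B B0 B1.
  rewrite normrN !normrM !normfV !(ger0_norm (sqrtr_ge0 _)) normrX.
  rewrite (ger0_norm B0) normr_nat.
  rewrite [leRHS](_ : _ = (Num.sqrt (1 - `|y|))^-1 * (N.+1%:R * `|y| ^+ N.+1)
    / Num.sqrt (1 - y)); last by rewrite invfM mulrAC.
  rewrite ler_wpM2r ?invr_ge0 ?sqrtr_ge0// mulrC.
  apply: ler_pM.
  - by rewrite invr_ge0 sqrtr_ge0.
  - by rewrite mulr_ge0// mulr_ge0 ?exprn_ge0// mulr_ge0.
  - by rewrite lef_pV2 ?posrE.
  rewrite exprSr mulrA ler_wpM2r//; apply: ler_pM.
  - by rewrite mulr_ge0.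
  - by rewrite exprn_ge0.
  - by rewrite -[leRHS]mulr1 ler_wpM2l .
  - by rewrite lerXn2r ?nnegrE.
apply: (@squeeze_cvgr _ _ _ _
  (fun N => L - (Num.sqrt (1 - `|y|) * Num.sqrt (1 - y))^-1 *
    (N.+1%:R * `|y| ^+ N.+1))
  (fun N => L + (Num.sqrt (1 - `|y|) * Num.sqrt (1 - y))^-1 *
    (N.+1%:R * `|y| ^+ N.+1))).
- by apply: nearW => N; rewrite -ler_distl bound.
- by rewrite -[X in _ --> X]subr0; apply: cvgB; [exact: cvg_cst|exact: small].
- by rewrite -[X in _ --> X]addr0; apply: cvgD; [exact: cvg_cst|exact: small].
Qed.

(** * The Lauricella function with parameters 1/2 *)

Lemma one_sub_mul_gt0 (R : realType) (x u : R) : x < 1 -> 0 <= u <= 1 -> 0 < 1 - x * u.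
Proof.
move=> x1 /andP[]; rewrite le_eqVlt => /predU1P[<- _|u0 u1]; last by nra.
by rewrite mulr0 subr0.
Qed.

Lemma sin2_le1 (R : realType) (t : R) : 0 <= sin t ^+ 2 <= 1.
Proof. by rewrite sqr_ge0 -(cos2Dsin2 t) lerDr sqr_ge0. Qed.

Lemma continuous_sin2 (R : realType) : continuous (fun t : R => sin t ^+ 2).
Proof.
by move=> t; apply: (@continuous_comp _ _ _ sin (fun x => x ^+ 2));
  [exact: continuous_sin|exact: exprn_continuous].
Qed.

Lemma integral_quarter_oo (R : realType) (h : R -> R) : continuous h ->
  (\int[lebesgue_measure]_(t in `]0%R, (pi / 2)%R[) (h t)%:E =
   \int[lebesgue_measure]_(t in `[0%R, (pi / 2)%R]) (h t)%:E)%E.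
Proof.
move=> ch; rewrite [RHS]integral_itv_bndoo//; apply/measurable_EFinP.
by apply: measurable_funTS; exact: continuous_measurable_fun.
Qed.

Lemma Rintegral_quarter_sum (R : realType) (I : Type) (s : seq I) (h : I -> R -> R) :
  (forall i, continuous (h i)) ->
  \int[lebesgue_measure]_(t in `[0, pi / 2]) \sum_(i <- s) h i t =
  \sum_(i <- s) \int[lebesgue_measure]_(t in `[0, pi / 2]) h i t.
Proof.
move=> ch; elim: s => [|i s IH].
  rewrite big_nil; under eq_Rintegral do rewrite big_nil.
  by rewrite Rintegral_cst// mul0r.
rewrite big_cons -IH -RintegralD//.
- by apply: eq_Rintegral => t _; rewrite big_cons.
- exact: integrable_quarter.
- apply: integrable_quarter; apply: continuous_big => //.
  exact: add_continuous.
Qed.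

(** The part of the Euler integrand that depends on the arguments x_j. *)
Definition euler_kernel (R : realType) n (x : n.-tuple R) (u : R) : R :=
  \prod_j (Num.sqrt (1 - tnth x j * u))^-1.

Lemma continuous_euler_kernel (R : realType) n (x : n.-tuple R) (u : R) :
  (forall j, tnth x j < 1) -> 0 <= u <= 1 -> {for u, continuous (euler_kernel x)}.
Proof.
move=> x1 u01; apply: cvg_big => [|j _]; first exact: mul_continuous.
apply: (@continuous_sqrt_inv R (fun u => 1 - tnth x j * u)).
  exact: one_sub_mul_gt0.
apply: continuousB; first exact: cst_continuous.
by apply: continuousM; [exact: cst_continuous|exact: cvg_id].
Qed.

Lemma euler_kernel_ge0 (R : realType) n (x : n.-tuple R) (u : R) : 0 <= euler_kernel x u.
Proof. by apply: prodr_ge0 => j _; rewrite invr_ge0 sqrtr_ge0. Qed.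

Lemma continuous_euler_kernel_sin2 (R : realType) n (x : n.-tuple R) :
  (forall j, tnth x j < 1) -> continuous (fun t => euler_kernel x (sin t ^+ 2)).
Proof.
move=> x1 t; apply: (@continuous_comp _ _ _ (fun t => sin t ^+ 2) (euler_kernel x)).
  exact: continuous_sin2.
by apply: continuous_euler_kernel => //; exact: sin2_le1.
Qed.

(** Under u = sin(t)^2 the weight u^(-1/2) (1 - u)^(-1/2) du becomes 2 dt, and the
    Gamma factors give 1 / pi. *)
Lemma lauricellaD_integral_half (R : realType) n (x beta : n.-tuple R) :
  (forall j, tnth beta j = 1 / 2) -> (forall j, tnth x j < 1) ->
  lauricellaD_integral (1 / 2) beta 1 x = 2 / pi *
    \int[lebesgue_measure]_(t in `[0, pi / 2]) euler_kernel x (sin t ^+ 2).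
Proof.
move=> beta_half x1.
have half_sub : 1 - 1 / 2 = 1 / 2 :> R by field.
rewrite /lauricellaD_integral half_sub Gamma1 Gamma_half -expr2 sqr_sqrtr ?pi_ge0//.
pose G (u : R) := (Num.sqrt u)^-1 * (Num.sqrt (1 - u))^-1 * euler_kernel x u.
have cG (u : R) : 0 < u < 1 -> {for u, continuous G}.
  move=> /andP[u0 u1]; apply: continuousM; last first.
    by apply: continuous_euler_kernel => //; rewrite !ltW.
  apply: continuousM; apply: continuous_sqrt_inv; rewrite ?subr_gt0//.
  by apply: continuousB; [exact: cst_continuous|exact: cvg_id].
rewrite (_ : \int[_]_(_ in _) _ = \int[lebesgue_measure]_(u in `[0, 1]) G u); last first.
  apply: eq_Rintegral => u; rewrite inE/= in_itv/= => /andP[u0 u1].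
  rewrite !powR_half_sub1 ?subr_ge0// /G -prodfV; congr (_ * _).
  apply: eq_bigr => j _; rewrite beta_half powR_half// ltW// one_sub_mul_gt0//.
  by rewrite u0.
have sub01 (u : R) : u \in `]0, 1[ -> 0 < u < 1 by rewrite in_itv.
rewrite [in LHS]/Rintegral integral_itv_bndoo; last first.
  apply/measurable_EFinP; apply: open_continuous_measurable_fun.
    exact: interval_open.
  by move=> u /set_mem /sub01 /cG.
have -> : (\int[lebesgue_measure]_(u in `]0%R, 1%R[) (G u)%:E =
    \int[lebesgue_measure]_(t in `]0%R, (pi / 2)%R[)
      (G (sin t ^+ 2) * (2 * sin t * cos t))%:E)%E.
  have := @ge0_substitution_oo R (fun t => sin t ^+ 2)
    (fun t => 2 * sin t * cos t) G 0 (pi / 2).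
  rewrite sin0 sin_pihalf expr0n expr1n /=; apply.
  - exact: pihalf_gt0.
  - exact/continuous_subspaceT/continuous_sin2.
  - move=> t _; move: (is_derive1X 2 (is_derive_sin t)) => /is_derive_ext.
    by apply => //; rewrite expr1.
  - move=> t; rewrite in_itv/= => /andP[t0 t1].
    rewrite !mulr_gt0 ?sin_gt0_pihalf ?cos_gt0_pihalf ?t0 ?t1//.
    by rewrite (lt_trans _ t0)// oppr_lt0 pihalf_gt0.
  - move=> t _; apply: cvgM; last exact: continuous_cos.
    by apply: cvgM; [exact: cvg_cst|exact: continuous_sin].
  - by move=> u /sub01 /cG.
  - move=> u _; rewrite !mulr_ge0 ?invr_ge0 ?sqrtr_ge0//.
    exact: euler_kernel_ge0.
have -> : (\int[lebesgue_measure]_(t in `]0%R, (pi / 2)%R[)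
      (G (sin t ^+ 2) * (2 * sin t * cos t))%:E =
    \int[lebesgue_measure]_(t in `]0%R, (pi / 2)%R[)
      (2 * euler_kernel x (sin t ^+ 2))%:E)%E.
  apply: eq_integral => t; rewrite inE/= in_itv/= => /andP[t0 t1]; congr EFin.
  have st : 0 < sin t by rewrite sin_gt0_pihalf// t0.
  have ct : 0 < cos t.
    by rewrite cos_gt0_pihalf// t1 (lt_trans _ t0)// oppr_lt0 pihalf_gt0.
  rewrite /G -cos2sin2 !sqrtr_sqr !gtr0_norm//.
  by field; rewrite !gt_eqF.
have ce := continuous_euler_kernel_sin2 x1.
rewrite integral_quarter_oo; last first.
  by move=> t; apply: cvgM; [exact: cvg_cst|exact: ce].
rewrite -[fine _]/(\int[lebesgue_measure]_(t in `[0, pi / 2]) (2 * euler_kernel x (sin t ^+ 2))).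
rewrite RintegralZl//; last exact: integrable_quarter.
by rewrite mulrA [1 / pi * 2]mulrC mul1r.
Qed.

Lemma lauricellaD_term_half (R : realType) n (x beta : n.-tuple R) (m : 'I_n -> nat) :
  (forall j, tnth beta j = 1 / 2) ->
  lauricellaD_term (1 / 2) beta 1 x m =
  half_coef R (\sum_j m j) * \prod_j (half_coef R (m j) * tnth x j ^+ m j).
Proof.
move=> beta_half; rewrite /lauricellaD_term pochhammer1.
have -> : \prod_j pochhammer (tnth beta j) (m j) = \prod_j pochhammer (1 / 2) (m j).
  by apply: eq_bigr => j _; rewrite beta_half.
rewrite big_split/= prodf_div /half_coef invfM; ring.
Qed.

(** Distributing the product over the sums gives one term for each point of the box;
    s collects the total degree, which the Lauricella coefficient depends on. *)
Lemma prod_half_sum (R : realType) n (x : n.-tuple R) (N : nat) (s : R) :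
  \prod_j half_sum N (tnth x j * s) =
  \sum_(m : {ffun 'I_n -> 'I_N})
    (\prod_j (half_coef R (m j) * tnth x j ^+ m j)) * s ^+ \sum_j m j.
Proof.
rewrite /half_sum bigA_distr_bigA; apply: eq_bigr => m _.
rewrite -prodrXr -big_split/=; apply: eq_bigr => j _.
by rewrite exprMn mulrA.
Qed.

Lemma continuous_half_sum (R : realType) N : continuous (@half_sum R N).
Proof.
move=> y; apply/differentiable_continuous/derivable1_diffP.
by have := is_derive_half_sum N y.
Qed.

Lemma continuous_prod_half_sum_sin2 (R : realType) n (x : n.-tuple R) N :
  continuous (fun t => \prod_j half_sum N (tnth x j * sin t ^+ 2)).
Proof.
apply: continuous_big => [|j _ t]; first exact: mul_continuous.
apply: (@continuous_comp _ _ _ (fun t => tnth x j * sin t ^+ 2) (half_sum N)).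
  by apply: cvgM; [exact: cvg_cst|exact: continuous_sin2].
exact: continuous_half_sum.
Qed.

(** [Wallis] at the total degree M supplies the quotient (1/2)_M / (1)_M of each
    term. *)
Lemma lauricellaD_box_half (R : realType) n (x beta : n.-tuple R) N :
  (forall j, tnth beta j = 1 / 2) ->
  \sum_(m : {ffun 'I_n -> 'I_N}) lauricellaD_term (1 / 2) beta 1 x (fun j => m j) =
  2 / pi * \int[lebesgue_measure]_(t in `[0, pi / 2])
    \prod_j half_sum N (tnth x j * sin t ^+ 2).
Proof.
move=> beta_half; under eq_Rintegral do rewrite prod_half_sum.
have cpow k : continuous (fun t : R => (sin t ^+ 2) ^+ k).
  move=> t; apply: (@continuous_comp _ _ _ (fun t => sin t ^+ 2) (fun y => y ^+ k)).
    exact: continuous_sin2.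
  exact: exprn_continuous.
rewrite Rintegral_quarter_sum; last first.
  by move=> m t; apply: cvgM; [exact: cvg_cst|exact: cpow].
rewrite mulr_sumr; apply: eq_bigr => m _.
rewrite RintegralZl//; last exact: integrable_quarter.
rewrite Wallis lauricellaD_term_half//.
by move: (lt0r_neq0 (pi_gt0 R)); move: pi => p p0; field.
Qed.

(** Each partial sum in the product is at most (1 - |x_j|)^(-1/2) in absolute value,
    whatever N and t are, so dominated convergence applies with a constant. *)
Lemma lauricellaD_series_half (R : realType) n (x beta : n.-tuple R) :
  (forall j, tnth beta j = 1 / 2) -> (forall j, `|tnth x j| < 1) ->
  lauricellaD_series (1 / 2) beta 1 x = 2 / pi *
    \int[lebesgue_measure]_(t in `[0, pi / 2]) euler_kernel x (sin t ^+ 2).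
Proof.
move=> beta_half x1.
have x_lt1 j : tnth x j < 1 by exact: le_lt_trans (ler_norm _) (x1 j).
have xs_le j (t : R) : `|tnth x j * sin t ^+ 2| <= `|tnth x j|.
  have /andP[s0 s1] := sin2_le1 t.
  by rewrite normrM [`|sin t ^+ 2|]ger0_norm// ler_piMr.
rewrite /lauricellaD_series; under eq_fun do rewrite lauricellaD_box_half//.
apply/cvg_lim => //; apply: cvgM; first exact: cvg_cst.
pose M := \prod_j (Num.sqrt (1 - `|tnth x j|))^-1.
have ce := continuous_euler_kernel_sin2 x_lt1.
apply: fine_cvg; rewrite fineK; last first.
  apply: integrable_fin_num; first exact: measurable_itv.
  exact: integrable_quarter ce.
apply: (@dominated_cvg _ _ _ lebesgue_measure _ _ _ _ (fun=> M%:E)) => //.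
- move=> N; apply/measurable_EFinP/measurable_funTS.
  apply: continuous_measurable_fun.
  exact: continuous_prod_half_sum_sin2.
- move=> t _; apply: cvg_EFin; first exact: nearW.
  apply: cvg_big => [|j _]; first exact: mul_continuous.
  by apply: cvg_half_sum; exact: le_lt_trans (xs_le j t) (x1 j).
- by apply: integrable_quarter => t; exact: cvg_cst.
- move=> N t _; rewrite lee_fin normr_prod; apply: ler_prod => j _.
  have xs1 := le_lt_trans (xs_le j t) (x1 j).
  rewrite normr_ge0/= (le_trans (norm_half_sum_le N xs1))//.
  rewrite lef_pV2 ?posrE ?sqrtr_gt0 ?subr_gt0//.
  by rewrite ler_wsqrtr// lerD2l lerN2.
Qed.

Lemma lauricellaD_half (R : realType) n (x beta : n.-tuple R) :
  (forall j, tnth beta j = 1 / 2) -> (forall j, tnth x j < 1) ->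
  lauricellaD (1 / 2) beta 1 x = 2 / pi *
    \int[lebesgue_measure]_(t in `[0, pi / 2]) euler_kernel x (sin t ^+ 2).
Proof.
move=> beta_half x1; rewrite /lauricellaD.
case: ifP => [/forallP|_]; first exact: lauricellaD_series_half.
exact: lauricellaD_integral_half.
Qed.

(** * Splitting the period of genus 2 into elliptic integrals *)

(** In terms of y = 1 - u, the product of the factors b^4 - 1 + u,
    b^2 - a^2 + a^2 u and a^2 b^2 - 1 + u of the Euler integrand. *)
Definition genus2_cubic (R : realType) (a b s : R) : R :=
  (b ^+ 4 - s) * (b ^+ 2 - a ^+ 2 * s) * (a ^+ 2 * b ^+ 2 - s).

Lemma genus2_cubic_gt0 (R : realType) (a b s : R) :
  1 < a -> a < b -> 0 <= s <= 1 -> 0 < genus2_cubic a b s.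
Proof.
move=> a1 ab /andP[s0 s1].
have b1 : 1 < b by exact: lt_trans a1 ab.
have a2 : 1 < a ^+ 2 by rewrite exprn_egt1.
have b2 : 1 < b ^+ 2 by rewrite exprn_egt1.
have b4 : 1 < b ^+ 4 by rewrite exprn_egt1.
have ab2 : a ^+ 2 < b ^+ 2 by rewrite !expr2; nra.
rewrite /genus2_cubic !mulr_gt0// ?subr_gt0.
- by lra.
- by rewrite (le_lt_trans _ ab2)// ler_piMr// sqr_ge0.
- by rewrite (le_lt_trans s1)// mulr_egt1.
Qed.

Lemma continuous_inv_sqrt_genus2 (R : realType) (a b : R) : 1 < a -> a < b ->
  continuous (fun t => (Num.sqrt (genus2_cubic a b (sin t ^+ 2)))^-1).
Proof.
move=> a1 ab t; apply: (@continuous_sqrt_inv R (fun t => genus2_cubic a b (sin t ^+ 2))).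
  exact/genus2_cubic_gt0/sin2_le1.
have cs : {for t, continuous (fun t : R => sin t ^+ 2)} by exact: continuous_sin2.
apply: continuousM; [apply: continuousM|]; apply: continuousB;
  do ?exact: cst_continuous; do ?exact: cs.
by apply: continuousM; [exact: cst_continuous|exact: cs].
Qed.

(** The substitution x = (b^2 + e) s / (b^2 + e s^2) with s = sin t maps ]0, pi/2[
    increasingly onto ]0, 1[. With d = b^2 + e s^2 and e^2 = 1 one has
    1 - x^2 = (b^4 - s^2) (1 - s^2) / d^2 and
    1 - k^2 x^2 = (b^2 - a^2 s^2) (a^2 b^2 - s^2) / (a d)^2,
    so that the factor cos t of dx cancels the singularity at x = 1. *)
Lemma ellipticK_sin (R : realType) (a b e : R) :
  1 < a -> a < b -> e = 1 \/ e = -1 ->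
  ellipticK (b * (a ^+ 2 + e) / (a * (b ^+ 2 + e))) =
  \int[lebesgue_measure]_(t in `[0, pi / 2])
    (a * (b ^+ 2 + e) * (b ^+ 2 - e * sin t ^+ 2)
     / Num.sqrt (genus2_cubic a b (sin t ^+ 2))).
Proof.
move=> a1 ab e1.
have b1 : 1 < b by exact: lt_trans a1 ab.
have a2 : 1 < a ^+ 2 by rewrite exprn_egt1.
have b2 : 1 < b ^+ 2 by rewrite exprn_egt1.
have be_gt0 (s : R) : 0 <= s <= 1 -> 0 < b ^+ 2 + e * s.
  by case/andP => s0 s1; case: e1 => ->; lra.
have be'_gt0 (s : R) : 0 <= s <= 1 -> 0 < b ^+ 2 - e * s.
  by case/andP => s0 s1; case: e1 => ->; lra.
have be1 : 0 < b ^+ 2 + e by have := be_gt0 1; rewrite mulr1 ler01 lexx; apply.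
set k := b * (a ^+ 2 + e) / (a * (b ^+ 2 + e)).
have k01 : 0 <= k <= 1.
  have d0 : 0 < a * (b ^+ 2 + e) by rewrite mulr_gt0//; lra.
  apply/andP; split.
    by rewrite divr_ge0 ?(ltW d0)// mulr_ge0//; [lra|case: e1 => ->; lra].
  rewrite ler_pdivrMr// mul1r -subr_ge0.
  (* This factorization is the reason why k <= 1. *)
  have -> : a * (b ^+ 2 + e) - b * (a ^+ 2 + e) = (b - a) * (a * b - e) by ring.
  rewrite mulr_ge0 ?subr_ge0 ?(ltW ab)//.
  have : 1 < a * b by rewrite mulr_egt1.
  by case: e1 => -> ?; lra.
have kx (x : R) : 0 < x < 1 -> 0 < (1 - x ^+ 2) * (1 - k ^+ 2 * x ^+ 2).
  move=> /andP[x0 x1].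
  have x2 : x ^+ 2 < 1 by rewrite exprn_ilt1// ltW.
  rewrite mulr_gt0 ?subr_gt0// (le_lt_trans _ x2)// ler_piMl ?sqr_ge0//.
  by case/andP: k01 => k0 k1; exact: exprn_ile1.
pose G (x : R) := (Num.sqrt ((1 - x ^+ 2) * (1 - k ^+ 2 * x ^+ 2)))^-1.
have sub01 (u : R) : u \in `]0, 1[ -> 0 < u < 1 by rewrite in_itv.
have cG (x : R) : x \in `]0, 1[ -> {for x, continuous G}.
  move=> /sub01 /kx x0.
  apply: (@continuous_sqrt_inv R (fun x => (1 - x ^+ 2) * (1 - k ^+ 2 * x ^+ 2))) => //.
  have cX : {for x, continuous (fun x : R => x ^+ 2)} by exact: exprn_continuous.
  apply: continuousM; apply: continuousB; do ?exact: cst_continuous.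
    exact: cX.
  by apply: continuousM; [exact: cst_continuous|exact: cX].
rewrite /ellipticK. rewrite -/G [in LHS]/Rintegral integral_itv_bndoo; last first.
  apply/measurable_EFinP; apply: open_continuous_measurable_fun.
    exact: interval_open.
  by move=> u /set_mem /cG.
pose F (t : R) := (b ^+ 2 + e) * sin t / (b ^+ 2 + e * sin t ^+ 2).
pose f (t : R) := (b ^+ 2 + e) * cos t * (b ^+ 2 - e * sin t ^+ 2)
   / (b ^+ 2 + e * sin t ^+ 2) ^+ 2.
have cden (t : R) : {for t, continuous (fun t => b ^+ 2 + e * sin t ^+ 2)}.
  apply: continuousD; first exact: cst_continuous.
  by apply: continuousM; [exact: cst_continuous|exact: continuous_sin2].
have cnum (t : R) : {for t, continuous (fun t => b ^+ 2 - e * sin t ^+ 2)}.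
  apply: continuousB; first exact: cst_continuous.
  by apply: continuousM; [exact: cst_continuous|exact: continuous_sin2].
have den0 (t : R) : b ^+ 2 + e * sin t ^+ 2 != 0.
  by rewrite gt_eqF// be_gt0// sin2_le1.
have dF (t : R) : is_derive t 1 F (f t).
  have d1 : is_derive t 1 (fun t => b ^+ 2 + e * sin t ^+ 2)
      (e * (2 * sin t * cos t)).
    have := is_deriveD (is_derive_cst (b ^+ 2) t 1)
      (is_derive1M (is_derive_cst e t 1) (is_derive1X 2 (is_derive_sin t))).
    by move/is_derive_ext; apply => //=; rewrite expr1; ring.
  have d2 := @is_deriveV R _ t _ _ (den0 t) d1.
  have d3 := is_derive1M (is_derive1M (is_derive_cst (b ^+ 2 + e) t 1)
    (is_derive_sin t)) d2.
  move: d3 => /is_derive_ext; apply => //.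
  rewrite /f /GRing.scale/=; field; exact: den0.
have -> : (\int[lebesgue_measure]_(x in `]0%R, 1%R[) (G x)%:E =
    \int[lebesgue_measure]_(t in `]0%R, (pi / 2)%R[) (G (F t) * f t)%:E)%E.
  have := @ge0_substitution_oo R F f G 0 (pi / 2).
  have -> : F 0 = 0 by rewrite /F sin0 mulr0 mul0r.
  have -> : F (pi / 2) = 1.
    by rewrite /F sin_pihalf expr1n !mulr1 divff ?gt_eqF.
  apply.
  - exact: pihalf_gt0.
  - apply: continuous_subspaceT => t.
    by apply/differentiable_continuous/derivable1_diffP; have := dF t.
  - by move=> t _.
  - move=> t; rewrite in_itv/= => /andP[t0 t1].
    rewrite divr_gt0 ?exprn_gt0 ?be_gt0 ?sin2_le1// mulr_gt0 ?be'_gt0 ?sin2_le1//.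
    rewrite mulr_gt0// cos_gt0_pihalf// t1 (lt_trans _ t0)// oppr_lt0.
    exact: pihalf_gt0.
  - move=> t _; apply: cvgM.
      apply: cvgM; last exact: cnum.
      by apply: cvgM; [exact: cvg_cst|exact: continuous_cos].
    apply: cvgV; first by rewrite expf_neq0.
    apply: (@continuous_comp _ _ _ (fun t => b ^+ 2 + e * sin t ^+ 2) (fun x => x ^+ 2)).
      exact: cden.
    exact: exprn_continuous.
  - exact: cG.
  - by move=> x _; rewrite invr_ge0 sqrtr_ge0.
pose H (t : R) := a * (b ^+ 2 + e) * (b ^+ 2 - e * sin t ^+ 2)
     / Num.sqrt (genus2_cubic a b (sin t ^+ 2)).
have cH : continuous H.
  move=> t; apply: cvgM; last exact: continuous_inv_sqrt_genus2.
  by apply: cvgM; [exact: cvg_cst|exact: cnum].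
have -> : (\int[lebesgue_measure]_(t in `]0%R, (pi / 2)%R[) (G (F t) * f t)%:E =
    \int[lebesgue_measure]_(t in `]0%R, (pi / 2)%R[) (H t)%:E)%E.
  apply: eq_integral => t; rewrite inE/= in_itv/= => /andP[t0 t1]; congr EFin.
  have ct : 0 < cos t.
    by rewrite cos_gt0_pihalf// t1 (lt_trans _ t0)// oppr_lt0 pihalf_gt0.
  have s01 := sin2_le1 t.
  have D0 := genus2_cubic_gt0 a1 ab s01.
  have dt0 := be_gt0 _ s01.
  set D := genus2_cubic a b (sin t ^+ 2) in D0 *.
  set d := b ^+ 2 + e * sin t ^+ 2 in dt0.
  have a0 : a != 0 by rewrite gt_eqF//; lra.
  have be0 := lt0r_neq0 be1.
  have sD : Num.sqrt D != 0 by rewrite sqrtr_eq0 -ltNge.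
  have -> : G (F t) = (a * d ^+ 2) / (cos t * Num.sqrt D).
    have e2 : (1 - F t ^+ 2) * (1 - k ^+ 2 * F t ^+ 2) =
        (cos t / (a * d ^+ 2)) ^+ 2 * D.
      have cs := cos2sin2 t.
      rewrite [(cos t / _) ^+ 2]exprMn cs /F /k -/d /D /genus2_cubic.
      have := lt0r_neq0 dt0; rewrite /d.
      by case: e1 be0 => -> be0; rewrite ?mul1r ?mulN1r => d0; field; rewrite d0 a0.
    rewrite /G e2 sqrtrM ?sqr_ge0// sqrtr_sqr ger0_norm; last first.
      by rewrite divr_ge0 ?(ltW ct)// mulr_ge0 ?sqr_ge0//; lra.
    by field; rewrite sD a0 !lt0r_neq0.
  rewrite /f /H -/d -/D.
  by field; rewrite sD !gt_eqF.
by rewrite integral_quarter_oo.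
Qed.

Definition genus2_integral (R : realType) (a b : R) : R :=
  \int[lebesgue_measure]_(t in `[0, pi / 2])
    (Num.sqrt (genus2_cubic a b (sin t ^+ 2)))^-1.

(** The integrand is at least its value with each factor of the cubic replaced by
    its leading constant. *)
Lemma genus2_integral_gt0 (R : realType) (a b : R) :
  1 < a -> a < b -> 0 < genus2_integral a b.
Proof.
move=> a1 ab.
pose m := (Num.sqrt (b ^+ 4 * b ^+ 2 * (a ^+ 2 * b ^+ 2)))^-1.
have b0 : 0 < b by exact: lt_trans (lt_trans ltr01 a1) ab.
have a0 : 0 < a by exact: lt_trans ltr01 a1.
have m0 : 0 < m.
  by rewrite invr_gt0 sqrtr_gt0 !mulr_gt0// exprn_gt0.
apply: (@lt_le_trans _ _ (m * (pi / 2))); first by rewrite mulr_gt0// pihalf_gt0.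
rewrite -[pi / 2](lebesgue_measure_quarter R) -Rintegral_cst//.
apply: le_Rintegral => //.
- by apply: integrable_quarter => t; exact: cvg_cst.
- exact/integrable_quarter/continuous_inv_sqrt_genus2.
move=> t _; have s01 := sin2_le1 t; have D0 := genus2_cubic_gt0 a1 ab s01.
rewrite lef_pV2 ?posrE ?sqrtr_gt0// ?mulr_gt0 ?exprn_gt0//.
apply: ler_wsqrtr; case/andP: s01 => s0 s1.
have b2 : 1 <= b ^+ 2 by rewrite exprn_ege1// ltW// (lt_trans a1).
have b4 : 1 <= b ^+ 4 by rewrite exprn_ege1// ltW// (lt_trans a1).
have a2 : 1 <= a ^+ 2 by rewrite exprn_ege1// ltW.
have ab2 : a ^+ 2 <= b ^+ 2 by rewrite !expr2; nra.
have a2s : a ^+ 2 * sin t ^+ 2 <= a ^+ 2 by rewrite ler_piMr// sqr_ge0.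
have pab : 1 <= a ^+ 2 * b ^+ 2 by rewrite mulr_ege1.
have as0 : 0 <= a ^+ 2 * sin t ^+ 2 by rewrite mulr_ge0// sqr_ge0.
by rewrite /genus2_cubic !ler_pM// ?mulr_ge0 ?gerBl ?subr_ge0//; lra.
Qed.

(** The weights b^2 + 1 and b^2 - 1 make the terms in sin(t)^2 cancel. *)
Lemma ellipticK_sum (R : realType) (a b : R) : 1 < a -> a < b ->
  (b ^+ 2 + 1) * ellipticK (b * (a ^+ 2 - 1) / (a * (b ^+ 2 - 1)))
  + (b ^+ 2 - 1) * ellipticK (b * (a ^+ 2 + 1) / (a * (b ^+ 2 + 1)))
  = 2 * a * b ^+ 2 * (b ^+ 4 - 1) * genus2_integral a b.
Proof.
move=> a1 ab.
rewrite (ellipticK_sin a1 ab (or_intror erefl)) (ellipticK_sin a1 ab (or_introl erefl)).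
have cg := continuous_inv_sqrt_genus2 a1 ab.
have cK (e : R) : continuous (fun t : R => a * (b ^+ 2 + e) * (b ^+ 2 - e * sin t ^+ 2)
     / Num.sqrt (genus2_cubic a b (sin t ^+ 2))).
  move=> t; apply: cvgM; last exact: cg.
  apply: cvgM; first exact: cvg_cst.
  apply: cvgB; first exact: cvg_cst.
  by apply: cvgM; [exact: cvg_cst|exact: continuous_sin2].
rewrite -!RintegralZl//; do ?[exact: integrable_quarter].
rewrite -RintegralD//; last 2 first.
- by apply: integrable_quarter => t; apply: cvgM; [exact: cvg_cst|exact: cK].
- by apply: integrable_quarter => t; apply: cvgM; [exact: cvg_cst|exact: cK].
by apply: eq_Rintegral => t _; ring.
Qed.

Lemma Rintegral_quarter_reflect (R : realType) (h : R -> R) : continuous h ->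
  \int[lebesgue_measure]_(t in `[0, pi / 2]) h t =
  \int[lebesgue_measure]_(t in `[0, pi / 2]) h (pi / 2 - t).
Proof.
move=> ch; rewrite /Rintegral; congr fine.
pose F (t : R) := pi / 2 - t.
have dF (t : R) : is_derive t 1 F (-1).
  have := is_deriveB (is_derive_cst (pi / 2) t 1) (is_derive_id t 1).
  by move/is_derive_ext; apply => //; rewrite sub0r.
have F' : derive1 F = cst (-1).
  by apply/funext => t; rewrite derive1E; have := dF t => ?; rewrite derive_val.
have cF (t : R) : {for t, continuous F}.
  by apply/differentiable_continuous/derivable1_diffP; have := dF t.
have := @integration_by_substitution_decreasing R F h 0 (pi / 2).
have -> : F 0 = pi / 2 by rewrite /F subr0.
have -> : F (pi / 2) = 0 by rewrite /F subrr.
move=> ->.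
- by apply: eq_integral => t _; rewrite F' /= opprK mulr1.
- exact/ltW/pihalf_gt0.
- by move=> x y _ _ xy; rewrite /F ltrD2l ltrN2.
- by rewrite F' => t _; exact: cst_continuous.
- by rewrite F'; exact: is_cvg_cst.
- by rewrite F'; exact: is_cvg_cst.
- split=> [t _||]; first by have := dF t.
    exact/cvg_at_right_filter/cF.
  exact/cvg_at_left_filter/cF.
- exact: continuous_subspaceT.
Qed.

(** After t |-> pi/2 - t, each factor 1 - x_j cos(t)^2 is a factor of the cubic at
    sin(t)^2 divided by its value at y = 1. *)
Lemma lauricellaD_genus2 (R : realType) (a b : R) : 1 < a -> a < b ->
  lauricellaD (1 / 2) [tuple 1 / 2; 1 / 2; 1 / 2] 1
    [tuple 1 / (1 - b ^+ 4); 1 / (1 - a ^+ 2 * b ^+ 2); a ^+ 2 / (a ^+ 2 - b ^+ 2)]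
  = 2 / pi * (Num.sqrt ((b ^+ 4 - 1) * (a ^+ 2 * b ^+ 2 - 1) * (b ^+ 2 - a ^+ 2))
    * genus2_integral a b).
Proof.
move=> a1 ab.
have b1 : 1 < b by exact: lt_trans a1 ab.
have a2 : 1 < a ^+ 2 by rewrite exprn_egt1.
have b4 : 1 < b ^+ 4 by rewrite exprn_egt1.
have ab2 : a ^+ 2 < b ^+ 2 by rewrite !expr2; nra.
have pab : 1 < a ^+ 2 * b ^+ 2 by rewrite mulr_egt1// exprn_egt1.
set x := [tuple 1 / (1 - b ^+ 4); _; _].
have x1 j : tnth x j < 1.
  case: j; case=> [|[|[|]]]//= i; rewrite !(tnth_nth 0)/=.
  - by rewrite mul1r (@lt_trans _ _ 0)// invr_lt0 subr_lt0.
  - by rewrite mul1r (@lt_trans _ _ 0)// invr_lt0 subr_lt0.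
  - rewrite (@lt_trans _ _ 0)// pmulr_rlt0 ?invr_lt0 ?subr_lt0//.
    by rewrite (lt_trans ltr01).
rewrite lauricellaD_half//; last by case; case=> [|[|[|]]].
congr (_ * _); rewrite (Rintegral_quarter_reflect (continuous_euler_kernel_sin2 x1)).
rewrite /genus2_integral -RintegralZl//; last first.
  exact/integrable_quarter/continuous_inv_sqrt_genus2.
apply: eq_Rintegral => t _.
have -> : sin (pi / 2 - t) = cos t.
  by rewrite sinB sin_pihalf cos_pihalf mul1r mul0r subr0.
rewrite cos2sin2; have s01 := sin2_le1 t; have D0 := genus2_cubic_gt0 a1 ab s01.
move: (sin t ^+ 2) s01 D0 => s /andP[s0 s1] D0.
rewrite /euler_kernel !big_ord_recr big_ord0/= mul1r !(tnth_nth 0)/=.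
rewrite -!invfM -!sqrtrM.
set P := (b ^+ 4 - 1) * _ * _.
have P0 : 0 < P by rewrite !mulr_gt0// subr_gt0.
transitivity (Num.sqrt (genus2_cubic a b s / P))^-1.
  congr (Num.sqrt _)^-1; rewrite /P /genus2_cubic; field.
  rewrite exprMn !subr_eq0 !(gt_eqF ab2, gt_eqF pab, gt_eqF b4).
  by rewrite !(lt_eqF ab2, lt_eqF pab, lt_eqF b4).
by rewrite sqrtrM ?(ltW D0)// sqrtrV ?(ltW P0)// invfM invrK mulrC.
all: have u01 : 0 <= 1 - s <= 1 by rewrite subr_ge0 s1 gerBl.
all: have := one_sub_mul_gt0 (x1 (Ordinal (isT : (0 < 3)%N))) u01.
all: have := one_sub_mul_gt0 (x1 (Ordinal (isT : (1 < 3)%N))) u01.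
all: rewrite !(tnth_nth 0)/= => ? ?.
  by rewrite mulr_ge0 ?ltW.
by rewrite ltW.
Qed.


Theorem theorem4p5 (R : realType) (a b : R) (ha : 1 < a) (hab : a < b) :
  pi =
    Num.sqrt ((b ^+ 2 - a ^+ 2) * (a ^+ 2 * b ^+ 2 - 1))
      / (a * b ^+ 2 * Num.sqrt (b ^+ 4 - 1))
    * (((b ^+ 2 + 1) * ellipticK (b * (a ^+ 2 - 1) / (a * (b ^+ 2 - 1)))
        + (b ^+ 2 - 1) * ellipticK (b * (a ^+ 2 + 1) / (a * (b ^+ 2 + 1))))
       / lauricellaD (1 / 2) [tuple 1 / 2; 1 / 2; 1 / 2] 1
           [tuple 1 / (1 - b ^+ 4); 1 / (1 - a ^+ 2 * b ^+ 2);
                  a ^+ 2 / (a ^+ 2 - b ^+ 2)]).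
Proof.
rewrite ellipticK_sum// lauricellaD_genus2//.
have J0 := lt0r_neq0 (genus2_integral_gt0 ha hab).
have b1 : 1 < b by exact: lt_trans ha hab.
have a0 : a != 0 by rewrite gt_eqF// (lt_trans ltr01).
have b0 : b != 0 by rewrite gt_eqF// (lt_trans ltr01).
have b4 : 0 < b ^+ 4 - 1 by rewrite subr_gt0 exprn_egt1.
have ab2 : 0 < b ^+ 2 - a ^+ 2 by rewrite subr_gt0 !expr2; nra.
have pab : 0 < a ^+ 2 * b ^+ 2 - 1 by rewrite subr_gt0 mulr_egt1// exprn_egt1.
have -> : Num.sqrt ((b ^+ 4 - 1) * (a ^+ 2 * b ^+ 2 - 1) * (b ^+ 2 - a ^+ 2)) =
    Num.sqrt (b ^+ 4 - 1) * Num.sqrt ((b ^+ 2 - a ^+ 2) * (a ^+ 2 * b ^+ 2 - 1)).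
  by rewrite -mulrA [(_ - 1) * (b ^+ 2 - _)]mulrC sqrtrM// ltW.
have S2_sqr := sqr_sqrtr (ltW b4).
have S2_neq0 : Num.sqrt (b ^+ 4 - 1) != 0 by rewrite sqrtr_eq0 -ltNge.
have S1_neq0 : Num.sqrt ((b ^+ 2 - a ^+ 2) * (a ^+ 2 * b ^+ 2 - 1)) != 0.
  by rewrite sqrtr_eq0 -ltNge mulr_gt0.
set S2 := Num.sqrt (b ^+ 4 - 1) in S2_sqr S2_neq0 *; rewrite -S2_sqr.
move: (lt0r_neq0 (pi_gt0 R)); move: pi => p p0.
by field; rewrite p0 a0 b0 J0 S1_neq0 S2_neq0.
Qed.
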